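(* Let $n\ge 3$ and let $c_{ij}\ge 0$ ($1\le i,j\le n$) be travel costs. Fix $\varepsilon>0$. For $x=(x_{i,t})\in[0,1]^{n\times n}$, with the time index $t$ read cyclically modulo $n$, define $$Q(x):=\sum_{t=1}^n\sum_{i=1}^n\sum_{j=1}^n c_{ij}x_{i,t}x_{j,t+1},\qquad \rho_t(x):=\sum_{i=1}^n x_{i,t}-1,\qquad \kappa_i(x):=\sum_{t=1}^n x_{i,t}-1,$$ $$V_{\mathrm{time}}(x):=\sum_{t=1}^n\rho_t(x)^2+\sum_{i=1}^n\kappa_i(x)^2-2\sum_{i=1}^n\sum_{t=1}^n x_{i,t}^2+2\sum_{i=1}^n\sum_{t=1}^n x_{i,t},$$ $$\hat f_{\mathrm{time}}(x):=Q(x)+\varepsilon\sum_{i=1}^n\sum_{t=1}^n x_{i,t}+\gamma V_{\mathrm{time}}(x).$$ Then there exists a finite threshold $\gamma^\star_{\mathrm{time}}>0$ such that for all $\gamma>\gamma^\star_{\mathrm{time}}$, every local minimizer $x^\star$ of $\hat f_{\mathrm{time}}$ over $[0,1]^{n\times n}$ is binary, i.e. $x^\star\in\{0,1\}^{n\times n}$, and satisfies $$\sum_{i=1}^n x^\star_{i,t}=1\ \ \forall t,\qquad \sum_{t=1}^n x^\star_{i,t}=1\ \ \forall i.$$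
   Context: Time is cyclic: $x_{\cdot,n+1}:=x_{\cdot,1}$. A local minimizer over $[0,1]^{n\times n}$ is a point of the box minimizing $\hat f_{\mathrm{time}}$ among all points of the box in some neighborhood of it. *)

(* Defs.v *)
From HB Require Import structures.
From mathcomp Require Import all_boot all_order all_algebra.
From mathcomp Require Import all_classical all_reals all_analysis.

Set Implicit Arguments.
Unset Strict Implicit.
Unset Printing Implicit Defensive.

Import Order.TTheory GRing.Theory Num.Theory.
Import numFieldNormedType.Exports.

Local Open Scope classical_set_scope.
Local Open Scope ring_scope.

Definition local_minimizer {R : realType} {T : topologicalType}
    (f : T -> R) (D : set T) (x : T) : Prop :=
  D x /\ \forall y \near x, D y -> f x <= f y.

Section TimeIndexed.
Context {R : realType} {n : nat}.
Implicit Types (c x : 'M[R]_n) (i t : 'I_n) (eps gamma : R).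

(* [x i t] is x_{i,t}; rows are cities, columns are time slots. *)

Definition unit_box : set 'M[R]_n :=
  [set x | forall i t, 0 <= x i t <= 1].

(* [ordS t] is the successor of [t] modulo [n]. *)
Definition Qcost c x : R :=
  \sum_(t < n) \sum_(i < n) \sum_(j < n) c i j * x i t * x j (ordS t).

Definition rho x t : R := \sum_(i < n) x i t - 1.

Definition kappa x i : R := \sum_(t < n) x i t - 1.

Definition Vtime x : R :=
  \sum_(t < n) rho x t ^+ 2 + \sum_(i < n) kappa x i ^+ 2
  - 2 * (\sum_(i < n) \sum_(t < n) x i t ^+ 2)
  + 2 * (\sum_(i < n) \sum_(t < n) x i t).

Definition fhat_time c eps gamma x : R :=
  Qcost c x + eps * (\sum_(i < n) \sum_(t < n) x i t) + gamma * Vtime x.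

End TimeIndexed.

(* Main.v *)
(* The objective is affine in each single entry of x: the penalty Vtime has
   zero diagonal second derivatives, and so has Qcost because the slots t and
   t + 1 differ.  Hence at a local minimizer the partial derivative is <= 0 at
   entries > 0 and >= 0 at entries < 1.  Up to a nonnegative travel cost term
   bounded by 2 B, the partial derivative at (i,t) is eps + 2 gamma (S - 1),
   where S is the sum of the other entries of row i and column t; so, once
   gamma > B + eps, a positive entry has S < 1 and an entry < 1 has S > 0.
   Two fractional entries in a common row or column are excluded by the mixed
   second derivative, which is at least 2 gamma > 0.  So the entries sharing a
   line with a fractional one vanish, which contradicts S > 0; thus x is
   binary, and it is a partial permutation matrix that cannot be extended. *)

Require Import Defs.
From HB Require Import structures.
From mathcomp Require Import all_boot all_order all_algebra.
From mathcomp Require Import all_classical all_reals all_analysis.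
From mathcomp Require Import ring lra.

Set Implicit Arguments.
Unset Strict Implicit.
Unset Printing Implicit Defensive.

Import Order.TTheory GRing.Theory Num.Theory.
Import numFieldNormedType.Exports.

Local Open Scope classical_set_scope.
Local Open Scope ring_scope.

(** * Sums in which one term is shifted *)

Section Sums.
Context {R : comNzRingType} {I : finType}.

Lemma sum_shift (u : I -> R) (h : R) (k : I) :
  \sum_i (u i + h * (i == k)%:R) = \sum_i u i + h.
Proof.
rewrite big_split /= -mulr_sumr [X in _ + _ * X](bigD1 k) //= eqxx.
by rewrite [X in true%:R + X]big1 ?addr0 ?mulr1 // => i /negbTE ->.
Qed.

Lemma sum_sqr_shift (u : I -> R) (h : R) (k : I) :
  \sum_i (u i + h * (i == k)%:R) ^+ 2 = \sum_i u i ^+ 2 + 2 * h * u k + h ^+ 2.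
Proof.
rewrite (bigD1 k) //= [in RHS](bigD1 k) //= eqxx mulr1.
rewrite (eq_bigr (fun i => u i ^+ 2)); first by ring.
by move=> i /negbTE ->; rewrite mulr0 addr0.
Qed.

End Sums.

(** * Exact expansion of the objective along one entry *)

Section Expansion.
Context {R : realType} {n : nat}.
Implicit Types (c x y d : 'M[R]_n) (i j s t : 'I_n) (eps gamma h : R).

(** Polarization of [Qcost]: its two slots are expanded separately by linearity, and the diagonal
    [Qbil c x x] is [Qcost c x] by conversion. *)
Definition Qbil c x y : R :=
  \sum_(t < n) \sum_(i < n) \sum_(j < n) c i j * x i t * y j (ordS t).

Lemma Qbil_shiftl c x d y h :
  Qbil c (x + h *: d) y = Qbil c x y + h * Qbil c d y.
Proof.
rewrite mulr_sumr -big_split; apply: eq_bigr => t _ /=.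
rewrite mulr_sumr -big_split; apply: eq_bigr => i _ /=.
rewrite mulr_sumr -big_split; apply: eq_bigr => j _ /=.
by rewrite !mxE; ring.
Qed.

Lemma Qbil_shiftr c x d y h :
  Qbil c y (x + h *: d) = Qbil c y x + h * Qbil c y d.
Proof.
rewrite mulr_sumr -big_split; apply: eq_bigr => t _ /=.
rewrite mulr_sumr -big_split; apply: eq_bigr => i _ /=.
rewrite mulr_sumr -big_split; apply: eq_bigr => j _ /=.
by rewrite !mxE; ring.
Qed.

Lemma ordS_neq t : (1 < n)%N -> ordS t != t.
Proof.
move=> n1; apply/eqP => /(congr1 val) /= tE; have := ltn_ord t.
rewrite leq_eqVlt => /orP[/eqP tn|tn].
  by move: tE n1; rewrite tn modnn => t0; rewrite -[X in (_ < X)%N]tn -t0.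
by move: tE; rewrite modn_small // => /eqP; rewrite gtn_eqF.
Qed.

Lemma Qbil_delta_self c i t :
  (1 < n)%N -> Qbil c (delta_mx i t) (delta_mx i t) = 0.
Proof.
move=> n1; apply: big1 => s _; apply: big1 => j _; apply: big1 => k _.
rewrite !mxE; have [->|_] := eqVneq s t; last by rewrite andbF mulr0 mul0r.
by rewrite (negbTE (ordS_neq t n1)) andbF mulr0.
Qed.

Lemma ler_Qbil c x x' y y' : (forall i j, 0 <= c i j) ->
  (forall i t, 0 <= x i t <= x' i t) -> (forall i t, 0 <= y i t <= y' i t) ->
  0 <= Qbil c x y <= Qbil c x' y'.
Proof.
move=> c0 xx' yy'; apply/andP; split.
  apply: sumr_ge0 => t _; apply: sumr_ge0 => i _; apply: sumr_ge0 => j _.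
  have /andP[x0 _] := xx' i t; have /andP[y0 _] := yy' j (ordS t).
  by rewrite !mulr_ge0.
apply: ler_sum => t _; apply: ler_sum => i _; apply: ler_sum => j _.
have /andP[x0 xle] := xx' i t; have /andP[y0 yle] := yy' j (ordS t).
by apply: ler_pM; rewrite ?mulr_ge0 // ler_wpM2l.
Qed.

Lemma delta_in_box i t : unit_box (delta_mx i t : 'M[R]_n).
Proof. by move=> j s; rewrite mxE ler0n lern1 leq_b1. Qed.

Lemma rho_shift x i t h s :
  rho (x + h *: delta_mx i t) s = rho x s + h * (s == t)%:R.
Proof.
rewrite /rho (eq_bigr (fun j => x j s + h * (s == t)%:R * (j == i)%:R)).
  by rewrite sum_shift; ring.
by move=> j _; rewrite !mxE -mulrA -natrM mulnb andbC.
Qed.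

Lemma kappa_shift x i t h j :
  kappa (x + h *: delta_mx i t) j = kappa x j + h * (j == i)%:R.
Proof.
rewrite /kappa (eq_bigr (fun s => x j s + h * (j == i)%:R * (s == t)%:R)).
  by rewrite sum_shift; ring.
by move=> s _; rewrite !mxE -mulrA -natrM mulnb.
Qed.

(** The partial derivative of [fhat_time] at entry [(i, t)]. The last parenthesis is S - 1, with S
    the sum of the other entries of row [i] and column [t]. *)
Definition dfhat c eps gamma x i t : R :=
  Qbil c (delta_mx i t) x + Qbil c x (delta_mx i t) + eps
  + 2 * gamma * (rho x t + kappa x i - 2 * x i t + 1).

(* The second-order terms [h ^+ 2 + h ^+ 2 - 2 * h ^+ 2] of [Vtime] cancel, and
   those of [Qcost] vanish because the slots [t] and [t + 1] differ. *)
Lemma fhat_time_shift c eps gamma x i t h : (1 < n)%N ->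
  fhat_time c eps gamma (x + h *: delta_mx i t) =
  fhat_time c eps gamma x + h * dfhat c eps gamma x i t.
Proof.
move=> n1; rewrite /fhat_time /Vtime; set y := x + h *: delta_mx i t.
(* Entries are indexed by pairs, so that the one-index shift lemmas also cover the double sums. *)
have yE (p : 'I_n * 'I_n) : y p.1 p.2 = x p.1 p.2 + h * (p == (i, t))%:R.
  by rewrite !mxE.
rewrite -[Qcost c y]/(Qbil c y y) -[Qcost c x]/(Qbil c x x).
rewrite (eq_bigr _ (fun s _ => congr1 (fun r => r ^+ 2) (rho_shift x i t h s))).
rewrite (eq_bigr _ (fun j _ => congr1 (fun r => r ^+ 2) (kappa_shift x i t h j))).
rewrite !sum_sqr_shift !pair_bigA /=.
rewrite (eq_bigr _ (fun p _ => congr1 (fun r => r ^+ 2) (yE p))).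
rewrite (eq_bigr _ (fun p _ => yE p)) sum_sqr_shift sum_shift /=.
rewrite !(Qbil_shiftl, Qbil_shiftr) Qbil_delta_self // /dfhat.
by ring.
Qed.

(** The factor of [h] is the mixed second derivative. Its penalty part is [2 * gamma] for distinct
    entries on a common line and 0 otherwise. *)
Lemma dfhat_shift c eps gamma x i t h j s :
  dfhat c eps gamma (x + h *: delta_mx i t) j s = dfhat c eps gamma x j s
  + h * (Qbil c (delta_mx j s) (delta_mx i t) + Qbil c (delta_mx i t) (delta_mx j s)
         + 2 * gamma * ((s == t)%:R + (j == i)%:R
                        - 2 * ((j == i) && (s == t))%:R)).
Proof.
by rewrite /dfhat Qbil_shiftl Qbil_shiftr rho_shift kappa_shift !mxE; ring.
Qed.

End Expansion.

(** * First and second order conditions at a local minimizer *)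

Section LocalMinimizers.
Context {R : realType} {n : nat}.
Implicit Types (x y : 'M[R]_n) (i j s t : 'I_n).

Lemma local_minimizer_entrywise (f : 'M[R]_n -> R) (D : set 'M[R]_n) x :
  local_minimizer f D x -> exists2 e : R, 0 < e &
    forall y, D y -> (forall i j, `|x i j - y i j| < e) -> f x <= f y.
Proof.
move=> [_ /nbhs_ballP[e /= e0 fe]]; exists e => // y Dy xy.
by apply: fe => //; split.
Qed.

Variables (c : 'M[R]_n) (eps gamma : R) (x : 'M[R]_n).
Hypothesis n_gt1 : (1 < n)%N.
Hypothesis c_ge0 : forall i j, 0 <= c i j.
Hypothesis gamma_gt0 : 0 < gamma.
Hypothesis x_min : local_minimizer (fhat_time c eps gamma) unit_box x.

Let x_box : unit_box x. Proof. by case: x_min. Qed.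

Lemma dfhat_le0 i t : 0 < x i t -> dfhat c eps gamma x i t <= 0.
Proof.
move=> xit; have [e e0 minx] := local_minimizer_entrywise x_min.
have [h [h0 hx he]] : exists h, [/\ 0 < h, h <= x i t & h < e].
  (* The first bound keeps the moved point in the box, the second keeps it in the neighborhood. *)
  exists (Num.min (x i t) (e / 2)).
  split; rewrite ?lt_min ?ge_min ?gt_min ?lexx //.
    by rewrite xit divr_gt0.
  by apply/orP; right; lra.
have y_box : unit_box (x + (- h) *: delta_mx i t).
  move=> j s; have := x_box j s; rewrite !mxE.
  by have [->|_] := eqVneq j i; have [->|_] := eqVneq s t;
    rewrite /= ?mulr1 ?mulr0; lra.
have := minx _ y_box; rewrite fhat_time_shift // => fle.
suff /fle : forall j s, `|x j s - (x + (- h) *: delta_mx i t) j s| < e by nra.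
move=> j s; rewrite !mxE opprD addNKr mulNr opprK normrM gtr0_norm //.
by case: (_ && _); rewrite /= ?normr1 ?normr0; lra.
Qed.

Lemma dfhat_ge0 i t : x i t < 1 -> 0 <= dfhat c eps gamma x i t.
Proof.
move=> xit; have [e e0 minx] := local_minimizer_entrywise x_min.
have [h [h0 hx he]] : exists h, [/\ 0 < h, h <= 1 - x i t & h < e].
  exists (Num.min (1 - x i t) (e / 2)).
  split; rewrite ?lt_min ?ge_min ?gt_min ?lexx //.
    by rewrite subr_gt0 xit divr_gt0.
  by apply/orP; right; lra.
have y_box : unit_box (x + h *: delta_mx i t).
  move=> j s; have := x_box j s; rewrite !mxE.
  by have [->|_] := eqVneq j i; have [->|_] := eqVneq s t;
    rewrite /= ?mulr1 ?mulr0; lra.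
have := minx _ y_box; rewrite fhat_time_shift // => fle.
suff /fle : forall j s, `|x j s - (x + h *: delta_mx i t) j s| < e by nra.
move=> j s; rewrite !mxE opprD addNKr normrN normrM gtr0_norm //.
by case: (_ && _); rewrite /= ?normr1 ?normr0; lra.
Qed.

(* Moving along [delta_mx i t - delta_mx j s] leaves the first order
   unchanged, while the coefficient of order 2 is at most [- 2 * gamma]. *)
Lemma fractional_entries_not_aligned i t j s :
  (i == j) != (t == s) -> 0 < x i t < 1 -> 0 < x j s < 1 -> False.
Proof.
move=> aligned xit xjs; have [e e0 minx] := local_minimizer_entrywise x_min.
have git : dfhat c eps gamma x i t = 0.
  by apply/eqP; rewrite eq_le dfhat_le0 ?dfhat_ge0; lra.
have gjs : dfhat c eps gamma x j s = 0.
  by apply/eqP; rewrite eq_le dfhat_le0 ?dfhat_ge0; lra.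
have [h [h0 hx hy he]] :
    exists h, [/\ 0 < h, h <= 1 - x i t, h <= x j s & h < e].
  exists (Num.min (Num.min (1 - x i t) (x j s)) (e / 2)).
  by split; rewrite ?lt_min ?ge_min ?gt_min ?lexx ?orbT //; lra.
pose y := x + h *: delta_mx i t + (- h) *: delta_mx j s.
have yE k l : y k l = x k l + h * ((k == i) && (l == t))%:R
                      - h * ((k == j) && (l == s))%:R.
  by rewrite !mxE mulNr.
have disj k l : ((k == i) && (l == t)) && ((k == j) && (l == s)) = false.
  apply/negP => /andP[/andP[/eqP ki /eqP lt] /andP[/eqP kj /eqP ls]].
  by move: aligned; rewrite -ki -lt kj ls !eqxx.
have y_box : unit_box y.
  move=> k l; rewrite /= yE; move: (disj k l) (x_box k l).
  have [/andP[/eqP -> /eqP ->]|_] := boolP ((k == i) && (l == t)).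
    by rewrite andTb => -> /=; rewrite mulr1 mulr0; lra.
  by have [/andP[/eqP -> /eqP ->]|_] := boolP ((k == j) && (l == s));
    rewrite /= ?mulr1 ?mulr0; lra.
have y_near k l : `|x k l - y k l| < e.
  rewrite yE ltr_norml; move: (disj k l).
  by case: (_ && (l == t)); case: (_ && (l == s)) => //= _;
    rewrite ?mulr1 ?mulr0; lra.
have delta_le k l k' l' : let d : 'M[R]_n := delta_mx k l in
    0 <= d k' l' <= d k' l'.
  by rewrite /= mxE ler0n lexx.
have /andP[B1 _] := ler_Qbil c_ge0 (delta_le j s) (delta_le i t).
have /andP[B2 _] := ler_Qbil c_ge0 (delta_le i t) (delta_le j s).
have h2 : 0 < h ^+ 2 * gamma by rewrite mulr_gt0 ?exprn_gt0.
have hB := mulr_ge0 (sqr_ge0 h) (addr_ge0 B1 B2).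
(* Both slopes at [x] vanish, so the value at [y] is that at [x] minus [h ^+ 2] times the mixed
   derivative, hence strictly smaller. *)
have := minx _ y_box y_near; rewrite !fhat_time_shift // dfhat_shift git gjs.
move: aligned; rewrite (eq_sym j) (eq_sym s).
by case: (i == j); case: (t == s) => //= _; lra.
Qed.

End LocalMinimizers.

(** * Line sums of maximal partial assignments *)

Section Assignments.
Context {R : realDomainType} {n : nat}.

Lemma sum_single (u : 'I_n -> R) i :
  (forall j, j != i -> u j = 0) -> \sum_j u j = u i.
Proof. by move=> u0; rewrite (bigD1 i) //= big1 ?addr0. Qed.

Lemma ler_sum2 (u : 'I_n -> R) i j :
  (forall k, 0 <= u k) -> j != i -> u i + u j <= \sum_k u k.
Proof.
move=> u0 ji; rewrite (bigD1 i) //= (bigD1 j) //= addrA lerDl.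
exact: sumr_ge0.
Qed.

(* A vanishing column forces all row sums to be 1, so that the total is n
   although it is a sum of n column sums at most 1, one of which is 0. *)
Lemma maximal_partial_assignment (x : 'M[R]_n) :
  (forall i t, 0 <= x i t) ->
  (forall i t, 0 < x i t -> \sum_j x j t = 1 /\ \sum_s x i s = 1) ->
  (forall i t, x i t = 0 -> 0 < \sum_j x j t + \sum_s x i s) ->
  forall t, \sum_i x i t = 1.
Proof.
move=> x0 x1 xmax.
have x_eq0 u : (forall i : 'I_n, ~ 0 < u i) -> (forall i, 0 <= u i) ->
    forall i, u i = 0 :> R.
  by move=> uN u0 i; have := u0 i; rewrite le_eqVlt => /orP[/eqP|/uN].
have col_le1 t : \sum_i x i t <= 1.
  have [/existsP[i /x1[->]]|/existsPn N] := boolP [exists i, 0 < x i t] => //.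
  by rewrite big1 // => i _; apply: (x_eq0 (x^~ t)) => // k; apply/negP.
move=> t; have [/existsP[i /x1[]]|/existsPn N] := boolP [exists i, 0 < x i t] => //.
have xt0 i : x i t = 0 by apply: (x_eq0 (x^~ t)) => // k; apply/negP.
have colt0 : \sum_i x i t = 0 by apply: big1.
have row1 i : \sum_s x i s = 1.
  have [/existsP[s /x1[]]|/existsPn Ni] := boolP [exists s, 0 < x i s] => //.
  have := xmax i t (xt0 i).
  rewrite colt0 add0r big1 ?ltxx // => s _.
  by apply: (x_eq0 (x i)) => // k; apply/negP.
have : \sum_s \sum_i x i s < \sum_(s < n) 1.
  rewrite (bigD1 t) //= [ltRHS](bigD1 t) //= colt0 ltr_leD // ler_sum //.
by rewrite exchange_big /= (eq_bigr (fun=> 1)) // ltxx.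
Qed.

End Assignments.


Theorem theorem3p8 (R : realType) (n : nat) (hn : (3 <= n)%N)
    (c : 'M[R]_n) (hc : forall i j : 'I_n, 0 <= c i j)
    (eps : R) (heps : 0 < eps) :
  exists2 gamma_star : R, 0 < gamma_star &
    forall gamma : R, gamma_star < gamma ->
    forall x : 'M[R]_n,
      local_minimizer (fhat_time c eps gamma) unit_box x ->
      [/\ forall i t : 'I_n, x i t = 0 \/ x i t = 1,
          forall t : 'I_n, \sum_(i < n) x i t = 1 &
          forall i : 'I_n, \sum_(t < n) x i t = 1].
Proof.
pose B := Qbil c (const_mx 1) (const_mx 1).
have B0 : 0 <= B.
  have le11 i t : 0 <= (const_mx 1 : 'M[R]_n) i t <= (const_mx 1 : 'M[R]_n) i t.
    by rewrite mxE ler01 lexx.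
  by have /andP[] := ler_Qbil hc le11 le11.
(* If S <= 0, the slope is at most [2 * B + eps - 2 * gamma], which is negative above this
   threshold. *)
exists (B + eps) => [|gamma gammaB x xmin]; first lra.
have n1 : (1 < n)%N by apply: leq_trans hn.
have g0 : 0 < gamma by lra.
have [xbox _] := xmin.
have x0 i t : 0 <= x i t by have := xbox i t => /andP[].
have dE i t : exists2 q, 0 <= q <= 2 * B & dfhat c eps gamma x i t =
    q + eps + 2 * gamma * (\sum_j x j t + \sum_s x i s - 2 * x i t - 1).
  exists (Qbil c (delta_mx i t) x + Qbil c x (delta_mx i t)); last first.
    by rewrite /dfhat /rho /kappa; ring.
  have le1 y : unit_box y -> forall i t, 0 <= y i t <= (const_mx 1 : 'M[R]_n) i t.
    by move=> yb j s; rewrite mxE; exact: yb.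
  have /andP[] := ler_Qbil hc (le1 _ (delta_in_box i t)) (le1 _ xbox).
  have /andP[] := ler_Qbil hc (le1 _ xbox) (le1 _ (delta_in_box i t)).
  by rewrite -/B; lra.
have line_lt1 i t : 0 < x i t -> \sum_j x j t + \sum_s x i s - 2 * x i t < 1.
  by move=> /(dfhat_le0 n1 xmin); have [q q0 ->] := dE i t; nra.
have line_gt0 i t : x i t < 1 -> 0 < \sum_j x j t + \sum_s x i s - 2 * x i t.
  by move=> /(dfhat_ge0 n1 xmin); have [q q0 ->] := dE i t; nra.
have col_ge i j t : j != i -> x i t + x j t <= \sum_k x k t.
  exact: (@ler_sum2 R n (x^~ t)).
have row_ge i s t : s != t -> x i t + x i s <= \sum_k x i k by exact: ler_sum2.
have le_col i t : x i t <= \sum_k x k t by rewrite (bigD1 i) //= lerDl sumr_ge0.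
have le_row i t : x i t <= \sum_k x i k by rewrite (bigD1 t) //= lerDl sumr_ge0.
have not_aligned := fractional_entries_not_aligned n1 hc g0 xmin.
have xbin i t : x i t = 0 \/ x i t = 1.
  have [|xi0] := leP (x i t) 0; first by have := x0 i t; left; lra.
  have [|xi1] := leP 1 (x i t); first by have := xbox i t; right; lra.
  have := line_lt1 i t xi0; have := line_gt0 i t xi1.
  (* Once the other entries of both lines vanish, S is 0, against [line_gt0]. *)
  rewrite (@sum_single _ _ (x^~ t) i) ?(@sum_single _ _ (x i) t); first lra.
  - move=> s st; have [|xs0] := leP (x i s) 0; first by have := x0 i s; lra.
    (* S < 1 bounds [x i s] below 1, so it would be a second fractional entry in row [i]. *)
    have := line_lt1 i t xi0; have := row_ge i s t st; have := le_col i t => ? ? ?.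
    exfalso; apply: (not_aligned i t i s).
    + by rewrite eqxx (eq_sym t) (negbTE st).
    + lra.
    + lra.
  - move=> j ji; have [|xj0] := leP (x j t) 0; first by have := x0 j t; lra.
    have := line_lt1 i t xi0; have := col_ge i j t ji; have := le_row i t => ? ? ?.
    exfalso; apply: (not_aligned i t j t).
    + by rewrite eqxx (eq_sym i) (negbTE ji).
    + lra.
    + lra.
have x1 i t : 0 < x i t -> \sum_j x j t = 1 /\ \sum_s x i s = 1.
  move=> xi0; have xi1 : x i t = 1 by case: (xbin i t) => // ?; lra.
  (* Another entry equal to 1 on either line would give S >= 1. *)
  have lt1 := line_lt1 i t xi0; rewrite -xi1; split.
    apply: (@sum_single _ _ (x^~ t)) => j ji; case: (xbin j t) => // ?.
    by have := col_ge i j t ji; have := le_row i t; lra.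
  apply: sum_single => s st; case: (xbin i s) => // ?.
  by have := row_ge i s t st; have := le_col i t; lra.
have xmax i t : x i t = 0 -> 0 < \sum_j x j t + \sum_s x i s.
  by move=> xi0; have := line_gt0 i t; rewrite xi0; lra.
split=> //; first exact: maximal_partial_assignment.
(* Row sums are column sums of the transpose, which satisfies the same hypotheses. *)
have trE i : \sum_t x i t = \sum_t x^T t i by apply: eq_bigr => t _; rewrite mxE.
have trE' t : \sum_i x i t = \sum_i x^T t i by apply: eq_bigr => i _; rewrite mxE.
move=> i; rewrite trE; apply: maximal_partial_assignment => {i}.
- by move=> i t; rewrite mxE.
- by move=> t i; rewrite mxE -trE -trE' => /x1[].
- by move=> t i; rewrite mxE -trE -trE' addrC; exact: xmax.
Qed.
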